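(* Let $R$ be a commutative ring with identity, let $S$ be a multiplicatively closed subset of $R$ satisfying the maximal multiple condition (e.g., $S$ is finite or $S\subseteq U(R)$, where $U(R)$ is the set of units of $R$), and let $M$ be an $R$-module. Then the following statements are equivalent: (a) $M$ is a fully $S$-idempotent module; (b) every cyclic submodule of $M$ is $S$-idempotent; (c) every element of $M$ is $S$-idempotent; (d) for all submodules $N$ and $K$ of $M$, there exists $s\in S$ such that $s(N\cap K)\subseteq (N:_R M)(K:_R M)M$.
   Context: For a submodule $N$ of an $R$-module $M$, $(N:_R M)=\{r\in R : rM\subseteq N\}$. A multiplicatively closed subset $S$ of $R$ satisfies the maximal multiple condition if there exists $s\in S$ such that $t\mid s$ (in $R$) for each $t\in S$. An element $x\in M$ is an $S$-idempotent element if there exist $s\in S$ and $a\in (Rx:_R M)$ such that $sx=ax$. A submodule $N$ of $M$ is an $S$-idempotent submodule if there exists $s\in S$ such that $sN\subseteq (N:_R M)^2M\subseteq N$; $M$ is fully $S$-idempotent if every submodule of $M$ is an $S$-idempotent submodule. *)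

(* Defs.v *)
From mathcomp Require Import all_boot all_algebra.
From mathcomp Require Import boolp classical_sets cardinality.

Set Implicit Arguments.
Unset Strict Implicit.
Unset Printing Implicit Defensive.

Import GRing.Theory.
Local Open Scope ring_scope.
Local Open Scope classical_set_scope.

Section Definitions.
Variable R : comPzRingType.

(* Subsets are Prop-valued sets, so that no decidability is built in;
   mulr_closed includes 1 \in S. *)
Definition mult_closed (S : set R) : Prop := mulr_closed (mem S).

Definition divides (t s : R) : Prop := exists c : R, s = c * t.

Definition max_multiple (S : set R) : Prop :=
  exists2 s, S s & forall t, S t -> divides t s.

(* The product of ideals I J: all finite sums of products. *)
Definition ideal_mul (I J : set R) : set R :=
  [set a | exists n (u v : 'I_n -> R),
    [/\ forall i, I (u i), forall i, J (v i) & a = \sum_(i < n) u i * v i]].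

Variable M : lmodType R.

Definition submodule (N : set M) : Prop := submod_closed (mem N).

Definition scale_set (r : R) (N : set M) : set M := [set r *: x | x in N].

(* The submodule I N: all finite sums of elements a x, a in I, x in N. *)
Definition ideal_smul (I : set R) (N : set M) : set M :=
  [set y | exists n (u : 'I_n -> R) (x : 'I_n -> M),
    [/\ forall i, I (u i), forall i, N (x i) & y = \sum_(i < n) u i *: x i]].

Definition colon (N : set M) : set R := [set r | scale_set r setT `<=` N].

Definition cyclic_submodule (x : M) : set M := [set r *: x | r in setT].

Definition S_idempotent_element (S : set R) (x : M) : Prop :=
  exists s a, [/\ S s, colon (cyclic_submodule x) a & s *: x = a *: x].

Definition S_idempotent_submodule (S : set R) (N : set M) : Prop :=
  exists2 s, S s &
    scale_set s N `<=` ideal_smul (ideal_mul (colon N) (colon N)) setT /\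
    ideal_smul (ideal_mul (colon N) (colon N)) setT `<=` N.

End Definitions.

Definition fully_S_idempotent (R : comPzRingType) (S : set R)
    (M : lmodType R) : Prop :=
  forall N : set M, submodule N -> S_idempotent_submodule S N.

Lemma submodule_cyclic (R : comPzRingType) (M : lmodType R) (x : M) :
  submodule (cyclic_submodule x).
Proof.
split=> [|a u v]; rewrite !inE; first by exists 0 => //; rewrite scale0r.
by case=> r _ <- [t _ <-]; exists (a * r + t) => //; rewrite scalerDl scalerA.
Qed.

Lemma max_multiple_finite (R : comPzRingType) (S : set R) :
  mult_closed S -> finite_set S -> max_multiple S.
Proof.
move=> [S1 SM] /finite_seqP[s defS]; exists (\prod_(x <- s) x).
  have sS x : x \in s -> x \in S by rewrite defS inE.
  rewrite -in_setE big_seq.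
  by apply: (big_ind (fun x => x \in S)) => [//| |i /sS//]; exact: SM.
move=> t; rewrite defS /= => ts.
by exists (\prod_(x <- rem t s) x); rewrite (big_rem t) //= mulrC.
Qed.

Lemma max_multiple_units (R : comPzRingType) (S : set R) :
  mult_closed S -> (forall t, S t -> exists u, u * t = 1) -> max_multiple S.
Proof.
move=> [+ _] SU; rewrite in_setE => S1; exists 1 => // t /SU[u <-].
by exists u.
Qed.

(* Main.v *)
(* If s x = a x with a in (Rx : M), then s^2 x = a^2 x lies in (Rx : M)^2 M.
   The scalar s depends on x, but s^2 divides the maximal multiple of S, which
   therefore works for all x of N :&: K at once.  Conversely (Rx : M)^2 M is
   contained in (Rx : M) x, since the second factor already sends M into Rx. *)
Require Import Defs.
From mathcomp Require Import all_boot all_algebra.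
From mathcomp Require Import boolp classical_sets cardinality.

Set Implicit Arguments.
Unset Strict Implicit.
Unset Printing Implicit Defensive.

Import GRing.Theory.
Local Open Scope ring_scope.
Local Open Scope classical_set_scope.

Section Colon.
Variables (R : comPzRingType) (M : lmodType R).
Implicit Types (x : M) (N K : set M) (I J : set R).

Lemma mult_closedM (S : set R) s t : mult_closed S -> S s -> S t -> S (s * t).
Proof. by case=> _ SM Ss St; rewrite -in_setE; apply: SM; rewrite in_setE. Qed.

Lemma submodule0 N : submodule N -> N 0.
Proof. by case; rewrite in_setE. Qed.

Lemma submoduleP N a x y : submodule N -> N x -> N y -> N (a *: x + y).
Proof. by case=> _ NP Nx Ny; rewrite -in_setE; apply: NP; rewrite in_setE. Qed.

Lemma submoduleZ N a x : submodule N -> N x -> N (a *: x).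
Proof.
by move=> subN Nx; rewrite -[_ *: _]addr0; apply: submoduleP (submodule0 subN).
Qed.

Lemma submodule_sum N n (x : 'I_n -> M) :
  submodule N -> (forall i, N (x i)) -> N (\sum_i x i).
Proof.
move=> subN Nx; apply: (big_ind N) => // [|y z Ny Nz]; first exact: submodule0.
by rewrite -[y]scale1r; apply: submoduleP.
Qed.

Lemma colonP N a : colon N a <-> forall x, N (a *: x).
Proof.
split=> [Na x|Na _ [x _ <-]]; last exact: Na.
by apply: Na; exists x.
Qed.

Lemma colonS N K : N `<=` K -> colon N `<=` colon K.
Proof. by move=> NK a Na x /Na /NK. Qed.

Lemma cyclic_submoduleS N x : submodule N -> N x -> cyclic_submodule x `<=` N.
Proof. by move=> subN Nx _ [a _ <-]; apply: submoduleZ. Qed.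

(** An element of [I J M] is a sum of sums of terms [(a * b) *: x], and [N] is closed under sums, so
    inclusions out of [I J M] can be tested on these generators. *)
Lemma ideal_smul_mulS I J N :
    submodule N -> (forall a b x, I a -> J b -> N ((a * b) *: x)) ->
  ideal_smul (ideal_mul I J) [set: M] `<=` N.
Proof.
move=> subN NIJ _ [n [u [x [IJu _ ->]]]]; apply: submodule_sum => // i.
have [m [a [b [Ia Jb ->]]]] := IJu i.
by rewrite scaler_suml; apply: submodule_sum => // j; apply: NIJ.
Qed.

Lemma mem_ideal_smul_mul I J a b x :
  I a -> J b -> ideal_smul (ideal_mul I J) [set: M] ((a * b) *: x).
Proof.
move=> Ia Jb; exists 1, (fun=> a * b), (fun=> x); split=> // [_|].
  by exists 1, (fun=> a), (fun=> b); split=> //; rewrite big_ord1.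
by rewrite big_ord1.
Qed.

(** Makes [(N : M) x] an admissible target for [ideal_smul_mulS]. *)
Lemma submodule_colon_scale N x : submodule N ->
  submodule [set a *: x | a in colon N].
Proof.
move=> subN; split=> [|c u v]; rewrite !inE.
  exists 0; last by rewrite scale0r.
  by apply/colonP => y; rewrite scale0r; apply: submodule0.
case=> [a /colonP Na <-] [b /colonP Nb <-].
exists (c * a + b); last by rewrite scalerDl scalerA.
by apply/colonP => y; rewrite scalerDl -scalerA; apply: submoduleP.
Qed.

Lemma S_idempotent_element_of_cyclic (S : set R) x :
  S_idempotent_submodule S (cyclic_submodule x) -> S_idempotent_element S x.
Proof.
move=> [s Ss [sx _]]; have subx := submodule_cyclic x.
(* Membership of [s *: x] in [(Rx : M) x] is exactly the required equation. *)
suff [a xa ax] : [set a *: x | a in colon (cyclic_submodule x)] (s *: x).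
  by exists s, a.
have subC := submodule_colon_scale x subx.
apply: (ideal_smul_mulS subC) (sx _ _); last first.
  by exists x => //; exists 1 => //; rewrite scale1r.
(* Since [b *: y = r *: x], commutativity gives [(a * b) *: y = r *: (a *: x)]. *)
move=> a b y xa /colonP/(_ y)[r _ rx].
by rewrite -scalerA -rx scalerA mulrC -scalerA; apply: submoduleZ => //; exists a.
Qed.

(** Apply [s *: x = a *: x] twice, swapping [s] and [a] in between; the two factors [a] then serve
    one colon ideal each. *)
Lemma S_idempotent_element_sqr (S : set R) x : mult_closed S ->
    S_idempotent_element S x ->
  exists s a, [/\ S s, colon (cyclic_submodule x) a & s *: x = (a * a) *: x].
Proof.
move=> Smul [s [a [Ss xa sx]]]; exists (s * s), a; split=> //.
  exact: mult_closedM.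
by rewrite -scalerA sx scalerA [s * a]mulrC -!scalerA sx.
Qed.

End Colon.

Theorem theorem2p13 (R : comPzRingType) (S : set R) (M : lmodType R)
    (S_mult : mult_closed S) (S_max : max_multiple S) :
  [<-> fully_S_idempotent S M;
       forall x : M, S_idempotent_submodule S (cyclic_submodule x);
       forall x : M, S_idempotent_element S x;
       forall N K : set M, submodule N -> submodule K ->
         exists2 s, S s &
           scale_set s (N `&` K) `<=`
             ideal_smul (ideal_mul (colon N) (colon K)) setT].
Proof.
tfae.
- by move=> idemM x; apply/idemM/submodule_cyclic.
- by move=> idemM x; apply: S_idempotent_element_of_cyclic.
- move=> idemM N K subN subK; have [s Ss smax] := S_max.
  exists s => // _ [x [Nx Kx] <-].
  have [t [a [St xa tx]]] := S_idempotent_element_sqr S_mult (idemM x).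
  (* With [s = c * t], the element [s *: x] equals [(a * a) *: (c *: x)], a single generator of the
     product. As [Rx] lies in both [N] and [K], [a] belongs to both colon ideals. *)
  have [c ->] := smax t St.
  rewrite -scalerA tx scalerA mulrC -scalerA; apply: mem_ideal_smul_mul.
    exact: colonS (cyclic_submoduleS subN Nx) _ xa.
  exact: colonS (cyclic_submoduleS subK Kx) _ xa.
(* Take [K = N]. The remaining inclusion holds for any submodule: [(a * b) *: x = a *: (b *: x)] and
   [a] sends [M] into [N]. *)
- move=> idemM N subN; have [s Ss sN] := idemM N N subN subN.
  exists s => //; split; first by rewrite setIid in sN.
  apply: ideal_smul_mulS => // a b x /colonP Na _.
  by rewrite -scalerA; apply: Na.
Qed.
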